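(* Let $\mathfrak{g}$ be the $7$-dimensional Lie algebra with basis $\{e_1,\dots,e_7\}$ whose Lie bracket is determined by $A_1\in\mathfrak{gl}_2(\mathbb{R})$ and $A,B,C\in\mathfrak{gl}_4(\mathbb{R})$ as described in the context, and let $\varphi=e^{127}+e^{347}+e^{567}+e^{135}-e^{146}-e^{236}-e^{245}$. Then: (i) $\ast\varphi=e^{3456}+\omega_7\wedge e^{12}+\omega_1\wedge e^{27}-\omega_2\wedge e^{17}$; (ii) $d\ast\varphi=-\operatorname{tr}(A)\,e^{34567}+\left(\theta(A)\omega_7-\operatorname{tr}(A_1)\,\omega_7+\theta(B)\omega_1+\theta(C)\omega_2\right)\wedge e^{127}$; (iii) $\ast d\ast\varphi=-\operatorname{tr}(A)\,e^{12}+\ast_{\mathfrak{g}_1}\left(\theta(A)\omega_7-\operatorname{tr}(A_1)\,\omega_7+\theta(B)\omega_1+\theta(C)\omega_2\right)$; (iv) $d\ast d\ast\varphi=\operatorname{tr}(A_1)\operatorname{tr}(A)\,e^{127}-\theta(A)\beta\wedge e^7-\theta(B)\beta\wedge e^1-\theta(C)\beta\wedge e^2$, where $\beta:=(\operatorname{tr}(A_1)+\operatorname{tr}(A))\,\omega_7+\theta(A^t)\omega_7+\theta(B^t)\omega_1+\theta(C^t)\omega_2$.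
   Context: $\mathfrak{g}$ is a $7$-dimensional Lie algebra with basis $\{e_1,\dots,e_7\}$, dual basis $\{e^1,\dots,e^7\}$, $e^{ij\dots}=e^i\wedge e^j\wedge\cdots$. The bracket is given by $A_1=\operatorname{ad}e_7|_{\operatorname{span}\{e_1,e_2\}}=\begin{pmatrix}x&z\\ y&w\end{pmatrix}$, $A=\operatorname{ad}e_7|_{\mathfrak{g}_1}$, $B=\operatorname{ad}e_1|_{\mathfrak{g}_1}$, $C=\operatorname{ad}e_2|_{\mathfrak{g}_1}$, where $\mathfrak{g}_1=\operatorname{span}\{e_3,e_4,e_5,e_6\}$ is an abelian ideal, $\operatorname{span}\{e_1,e_2\}$ is abelian, $\operatorname{span}\{e_7,e_1,e_2\}$ is a subalgebra, $\operatorname{tr}B=\operatorname{tr}C=0$, and $[A,B]=xB+yC$, $[A,C]=zB+wC$, $[B,C]=0$. The positive $3$-form $\varphi$ makes $\{e_1,\dots,e_7\}$ an oriented orthonormal basis; $\ast$ is its Hodge star and $\ast_{\mathfrak{g}_1}$ the Hodge star of $\Lambda^\bullet\mathfrak{g}_1^*$ (orientation $e^{3456}$). $\omega_7=e^{34}+e^{56}$, $\omega_1=e^{35}-e^{46}$, $\omega_2=-e^{36}-e^{45}$. For $M\in\mathfrak{gl}(\mathfrak{g}_1)$, $\theta(M)$ acts on $\Lambda^k\mathfrak{g}_1^*$ by $\theta(M)\alpha(v_1,\dots,v_k)=-\alpha(Mv_1,\dots,v_k)-\dots-\alpha(v_1,\dots,Mv_k)$. *)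

(* Defs.v *)
From mathcomp Require Import all_boot all_order all_algebra.
Set Implicit Arguments. Unset Strict Implicit. Unset Printing Implicit Defensive.
Import Order.TTheory GRing.Theory Num.Theory.
Local Open Scope ring_scope.

Section Forms.
Variable R : comRingType.

(* A (possibly inhomogeneous) exterior form on g = R^7 is represented by its
   values on tuples of basis vectors: alpha [:: i1; ..; ik] = alpha(e_i1,..,e_ik)
   for the degree-k component.  Basis index i : 'I_7 stands for e_(i+1). *)
Definition form := seq 'I_7 -> R.

Definition fadd (f g : form) : form := fun s => f s + g s.
Definition fsub (f g : form) : form := fun s => f s - g s.
Definition fscale (a : R) (f : form) : form := fun s => a * f s.

Definition eb (I : seq 'I_7) : form := fun s =>
  if size s == size I then
    \det (\matrix_(a < size I, b < size I) ((nth ord0 s a == nth ord0 I b)%:R : R))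
  else 0.

(* e^{i1...ik} with the paper's 1-based labels, e.g. ee [:: 1; 2; 7]%N = e^{127} *)
Definition ee (l : seq nat) : form := eb [seq (inord i.-1 : 'I_7) | i <- l].

Definition subt (s : seq 'I_7) (S : {set 'I_(size s)}) : seq 'I_7 :=
  [seq nth ord0 s (val i) | i <- enum S].

Definition shuf m (S : {set 'I_m}) : nat :=
  #|[set p : 'I_m * 'I_m | (p.1 \in S) && (p.2 \notin S) && (p.2 < p.1)%N]|.

(* wedge product: (a /\ b)(v_1..v_{p+q}) = sum over (p,q)-shuffles *)
Definition wedge (f g : form) : form := fun s =>
  \sum_(S : {set 'I_(size s)}) (-1) ^+ shuf S * f (subt S) * g (subt (~: S)).

(* Hodge star of the metric making e_1..e_7 oriented orthonormal
   (volume form e^{1234567}) *)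
Definition vol : form := eb (enum 'I_7).
Definition hodge (f : form) : form := fun s =>
  \sum_(S : {set 'I_7} | (#|S| + size s == 7)%N) f (enum S) * vol (enum S ++ s).

(* g1 = span {e3,e4,e5,e6} = indices 2..5 *)
Definition in_g1 (k : 'I_7) : bool := (2 <= k <= 5)%N.
Definition g1set : {set 'I_7} := [set k | in_g1 k].
Definition g1i (k : 'I_7) : 'I_4 := inord (k - 2).
Definition i2 (k : 'I_7) : 'I_2 := inord k.

(* Hodge star of Lambda g1^* (orientation e^{3456}), where Lambda g1^* is
   identified with the forms on g only involving e^3..e^6 *)
Definition vol_g1 : form := ee [:: 3; 4; 5; 6]%N.
Definition hodge_g1 (f : form) : form := fun s =>
  \sum_(S : {set 'I_7} | (S \subset g1set) && (#|S| + size s == 4)%N)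
     f (enum S) * vol_g1 (enum S ++ s).

(* theta(M) for M in gl(g1), M acting on g1 in the basis e3..e6
   (M e_j = sum_i M i j e_i):
   theta(M) a (v1..vk) = - sum_i a(v1,..,M v_i,..,vk) *)
Definition extg1 (M : 'M[R]_4) (k j : 'I_7) : R :=
  if in_g1 k && in_g1 j then M (g1i k) (g1i j) else 0.
Definition theta (M : 'M[R]_4) (f : form) : form := fun s =>
  - \sum_(i < size s) \sum_(k : 'I_7) extg1 M k (nth ord0 s i) * f (set_nth ord0 s i k).

(* The Lie bracket: ad e7 = A1 on span{e1,e2}, = A on g1; ad e1 = B on g1,
   ad e2 = C on g1; all other brackets of basis vectors not determined by
   antisymmetry vanish.  adp i j k = e^k([e_i, e_j]) contribution from the
   "active" element e_i in {e1,e2,e7}. *)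
Definition adp (A1 : 'M[R]_2) (A B C : 'M[R]_4) (i j k : 'I_7) : R :=
  if i == 6 :> nat then
    (if (j < 2)%N && (k < 2)%N then A1 (i2 k) (i2 j)
     else if in_g1 j && in_g1 k then A (g1i k) (g1i j) else 0)
  else if i == 0 :> nat then
    (if in_g1 j && in_g1 k then B (g1i k) (g1i j) else 0)
  else if i == 1 :> nat then
    (if in_g1 j && in_g1 k then C (g1i k) (g1i j) else 0)
  else 0.

(* structure constants: sc k i j = e^k([e_i, e_j]) *)
Definition sc A1 A B C (k i j : 'I_7) : R := adp A1 A B C i j k - adp A1 A B C j i k.

Definition rm2 (s : seq 'I_7) (i j : nat) : seq 'I_7 :=
  [seq nth ord0 s l | l <- iota 0 (size s) & (l != i) && (l != j)].

(* Chevalley-Eilenberg differential for structure constants c: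
   d a (v0..vk) = sum_{i<j} (-1)^(i+j) a([v_i,v_j], v0,..^i..^j..,vk) *)
Definition dform (c : 'I_7 -> 'I_7 -> 'I_7 -> R) (f : form) : form := fun s =>
  \sum_(i < size s) \sum_(j < size s | (i < j)%N)
     (-1) ^+ (i + j) * \sum_(k : 'I_7) c k (nth ord0 s i) (nth ord0 s j) * f (k :: rm2 s i j).

End Forms.

Declare Scope form_scope.
Delimit Scope form_scope with F.
Notation "f \+ g" := (fadd f g) : form_scope.
Notation "f \- g" := (fsub f g) : form_scope.
Notation "a \*: f" := (fscale a f) : form_scope.
Notation "f \wedge g" := (wedge f g) (at level 40, left associativity) : form_scope.

Definition phi0 {R : comRingType} : form R :=
  (ee R [:: 1; 2; 7]%N \+ ee R [:: 3; 4; 7]%N \+ ee R [:: 5; 6; 7]%N \+ ee R [:: 1; 3; 5]%N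
   \- ee R [:: 1; 4; 6]%N \- ee R [:: 2; 3; 6]%N \- ee R [:: 2; 4; 5]%N)%F.
Definition omega7 {R : comRingType} : form R := (ee R [:: 3; 4]%N \+ ee R [:: 5; 6]%N)%F.
Definition omega1 {R : comRingType} : form R := (ee R [:: 3; 5]%N \- ee R [:: 4; 6]%N)%F.
Definition omega2 {R : comRingType} : form R := ((-1) \*: ee R [:: 3; 6]%N \- ee R [:: 4; 5]%N)%F.

(* Main.v *)
(** Write [eps_a] for exterior multiplication by [e^a] and, for a matrix [m], [D_m]
    for the derivation of the exterior algebra with [e^a |-> sum_k m a k e^k].
    If [[e_i, e_j] = p_i e_j - p_j e_i], then [d = - sum_a eps_a o D_(p_a)]; here
    only [e_1], [e_2], [e_7] act, so [d] is explicit on [e^J /\ f] for [J] a subset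
    of [{1, 2, 7}] and [f] a form on [g1].

    Both Hodge stars feed a form to the first arguments of a volume form [v]:
    under this pairing, [eps_a] on the form is contraction of [v] by [e_a].  Thus
    [*(e^{127} /\ f) = *_{g1} f], and since [D_m] scales the volume form of [g1] by
    [tr m], acting with [D_m] on all its arguments gives
    [*_{g1} theta(M) = - (tr M + theta(M^t)) *_{g1}].  The [omega_i] being self-dual,
    the form of (iii) has star [- beta], and (iv) follows. *)

From HB Require Import structures.
Require Import Defs.
From mathcomp Require Import all_boot all_order all_algebra.
From mathcomp Require Import boolp functions.
From mathcomp Require Import ring.
Set Implicit Arguments. Unset Strict Implicit. Unset Printing Implicit Defensive.
Import GRing.Theory.
Local Open Scope ring_scope.

(** * Exterior multiplication, contraction and derivations *)

Section DeleteNth.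
Variables (T : Type) (x0 : T).
Implicit Types (s : seq T).

Definition rm1 s j := take j s ++ drop j.+1 s.

Lemma rm1E s j : rm1 s j = [seq nth x0 s l | l <- iota 0 (size s) & l != j].
Proof.
elim: s j => [|x s IH] [|j] //=; rewrite (iotaDl 1 0) filter_map -map_comp.
  by rewrite filter_predT (map_nth_iota0 x0 (leqnn _)) take_size /rm1 take0 drop1.
by congr cons; apply: IH.
Qed.

Lemma size_rm1 s j : (j < size s)%N -> size (rm1 s j) = (size s).-1.
Proof.
move=> js; rewrite /rm1 size_cat size_takel; last exact: ltnW.
by rewrite size_drop -{2}(subnKC js).
Qed.

Lemma nth_rm1 s j l : (j < size s)%N -> nth x0 (rm1 s j) l = nth x0 s (bump j l).
Proof.
move=> js; rewrite /rm1 nth_cat size_takel ?(ltnW js) // /bump.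
by case: ltnP => jl; [rewrite nth_take | rewrite nth_drop addSn subnKC].
Qed.

End DeleteNth.

Section Operators.
Variables (R : comNzRingType) (T : finType).

(* A multilinear form, of mixed degree, on the free module with basis [T], given by
   its values on tuples of basis vectors. *)
Definition cochain : Type := seq T -> R.

HB.instance Definition _ := GRing.Lmodule.copy cochain (seq T -> R^o).

Implicit Types (f g : cochain) (m : T -> T -> R) (c : R) (a b k x y : T).
Implicit Types (s p q : seq T) (F : T -> cochain).

Lemma cochainN f s : (- f) s = - f s :> R. Proof. by []. Qed.

Lemma cochainD f g s : (f + g) s = f s + g s :> R. Proof. by []. Qed.

Lemma cochainZ c f s : (c *: f) s = c * f s :> R. Proof. by []. Qed.

Lemma cochain_sum F s : (\sum_k F k) s = \sum_k F k s :> R.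
Proof. exact: (congr1 (@^~ s) (fct_sumE _ _ _)). Qed.

Definition cochainE := (cochainN, cochainD, cochainZ, cochain_sum).

Definition contract x f : cochain := fun s => f (x :: s).

Definition extmul a : cochain -> cochain :=
  fix extmul_a f s :=
    if s is x :: s' then (x == a)%:R * f s' - extmul_a (contract x f) s' else 0.

(* The derivation of exterior forms with [e^a |-> \sum_k m a k e^k]; the matrix [m]
   itself acts on the arguments, [e_x |-> \sum_k m k x e_k]. *)
Definition derive m : cochain -> cochain :=
  fix derive_m f s :=
    if s is x :: s' then
      \sum_k m k x * f (k :: s') + derive_m (contract x f) s'
    else 0.

Definition unit_cochain : cochain := fun s => (nilp s)%:R.

Lemma cochain_cons f x s : f (x :: s) = contract x f s. Proof. by []. Qed.

Lemma contract_extmul x a f :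
  contract x (extmul a f) = (x == a)%:R *: f - extmul a (contract x f).
Proof. by []. Qed.

Lemma contract_derive x m f :
  contract x (derive m f) = \sum_k m k x *: contract k f + derive m (contract x f).
Proof. by apply/funext => s; rewrite !cochainE. Qed.

Lemma contract_unit x : contract x unit_cochain = 0. Proof. by []. Qed.

Lemma contract_is_linear x : linear (contract x).
Proof. by []. Qed.

HB.instance Definition _ x :=
  GRing.isLinear.Build R cochain cochain _ (contract x) (contract_is_linear x).

Lemma extmul_is_linear a : linear (extmul a).
Proof.
move=> c f g; apply/funext => s; rewrite !cochainE.
elim: s f g => [|x s IH] f g; first by rewrite /= mulr0 addr0.
rewrite !cochain_cons !contract_extmul !contract_is_linear !cochainE IH; ring.
Qed.

HB.instance Definition _ a :=
  GRing.isLinear.Build R cochain cochain _ (extmul a) (extmul_is_linear a).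

Lemma derive_is_linear m : linear (derive m).
Proof.
move=> c f g; apply/funext => s; rewrite !cochainE.
elim: s f g => [|x s IH] f g; first by rewrite /= mulr0 addr0.
rewrite !cochain_cons !contract_derive !cochainE contract_is_linear IH.
rewrite mulrDr addrACA; congr (_ + _).
rewrite mulr_sumr -big_split; apply: eq_bigr => k _ /=.
by rewrite contract_is_linear !cochainE; ring.
Qed.

HB.instance Definition _ m :=
  GRing.isLinear.Build R cochain cochain _ (derive m) (derive_is_linear m).

Lemma contractZ x c f : contract x (c *: f) = c *: contract x f. Proof. by []. Qed.

Lemma contract_sum x (I : finType) (F : I -> cochain) :
  contract x (\sum_i F i) = \sum_i contract x (F i).
Proof. exact: linear_sum. Qed.

Lemma extmul0 a : extmul a 0 = 0. Proof. exact: linear0. Qed.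

Lemma extmulN a f : extmul a (- f) = - extmul a f.
Proof. exact: linearN. Qed.

Lemma extmulD a f g : extmul a (f + g) = extmul a f + extmul a g.
Proof. exact: linearD. Qed.

Lemma extmulB a f g : extmul a (f - g) = extmul a f - extmul a g.
Proof. exact: linearB. Qed.

Lemma extmulZ a c f : extmul a (c *: f) = c *: extmul a f.
Proof. exact: linearZ. Qed.

Lemma extmul_sum a F : extmul a (\sum_k F k) = \sum_k extmul a (F k).
Proof. exact: linear_sum. Qed.

Definition extmul_linear := (extmul0, extmulN, extmulD, extmulB, extmulZ, extmul_sum).

Lemma derive0 m : derive m 0 = 0. Proof. exact: linear0. Qed.

Lemma deriveD m f g : derive m (f + g) = derive m f + derive m g.
Proof. exact: linearD. Qed.

Lemma deriveB m f g : derive m (f - g) = derive m f - derive m g.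
Proof. exact: linearB. Qed.

Lemma deriveZ m c f : derive m (c *: f) = c *: derive m f.
Proof. exact: linearZ. Qed.

Lemma derivemD m m' f : derive (fun k j => m k j + m' k j) f = derive m f + derive m' f.
Proof.
apply/funext => s; rewrite cochainD; elim: s f => [|x s IH] f; first by rewrite addr0.
rewrite !cochain_cons !contract_derive !cochainD IH addrACA; congr (_ + _).
by rewrite !cochain_sum -big_split; apply: eq_bigr => k _; apply: mulrDl.
Qed.

Lemma derive_nth x0 m f s :
  derive m f s =
  \sum_(i < size s) \sum_k m k (nth x0 s i) * f (set_nth x0 s i k).
Proof.
elim: s f => [|x s IH] f; first by rewrite big_ord0.
by rewrite cochain_cons contract_derive cochainD cochain_sum IH [RHS]big_ord_recl.
Qed.

Lemma derivem0 f : derive (fun _ _ => 0) f = 0.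
Proof.
apply/funext => s; elim: s f => [|x s IH] f //.
rewrite cochain_cons contract_derive cochainD cochain_sum IH addr0.
by rewrite big1 // => k _; rewrite scale0r.
Qed.

Lemma sum_delta x F : \sum_k (x == k)%:R *: F k = F x.
Proof.
rewrite (bigD1 x) //= eqxx scale1r big1 ?addr0 // => k.
by rewrite eq_sym => /negPf->; rewrite scale0r.
Qed.

Lemma extmul_anticomm a b f : extmul a (extmul b f) = - extmul b (extmul a f).
Proof.
apply/funext => s; rewrite cochainN.
elim: s f => [|x s IH] f; first by rewrite /= oppr0.
by rewrite !cochain_cons !(contract_extmul, extmul_linear) !cochainE IH; ring.
Qed.

Lemma extmul_sqr a f : extmul a (extmul a f) = 0.
Proof.
apply/funext => s; elim: s f => [|x s IH] f //.
by rewrite cochain_cons !(contract_extmul, extmul_linear) !cochainE IH; ring.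
Qed.

Lemma extmul_sandwich a b f : extmul a (extmul b (extmul a f)) = 0.
Proof. by rewrite (extmul_anticomm b) extmulN extmul_sqr oppr0. Qed.

Lemma extmul_cycle a b k f :
  extmul a (extmul b (extmul k f)) = extmul b (extmul k (extmul a f)).
Proof. by rewrite extmul_anticomm (extmul_anticomm a) extmulN opprK. Qed.

Lemma derive_unit m : derive m unit_cochain = 0.
Proof.
apply/funext => -[|x s] //; rewrite cochain_cons contract_derive contract_unit derive0.
by rewrite addr0 big1 // => k _; rewrite contract_unit scaler0.
Qed.

Lemma derive_extmul m a f :
  derive m (extmul a f) = \sum_k m a k *: extmul k f + extmul a (derive m f).
Proof.
have contract_sum_extmul x g : contract x (\sum_k m a k *: extmul k g) =
    m a x *: g - \sum_k m a k *: extmul k (contract x g).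
  rewrite contract_sum -(sum_delta x (fun k => m a k *: g)) -sumrB.
  apply: eq_bigr => k _; rewrite scalerA mulrC -scalerA -scalerBr.
  exact: linearZ.
have sum_contract_extmul x g : \sum_k m k x *: contract k (extmul a g) =
    m a x *: g - extmul a (\sum_k m k x *: contract k g).
  rewrite extmul_sum -(sum_delta a (fun k => m k x *: g)) -sumrB.
  apply: eq_bigr => k _; rewrite extmulZ contract_extmul scalerBr !scalerA.
  by rewrite mulrC eq_sym.
apply/funext => s; elim: s f => [|x s IH] f; rewrite cochainD.
  by rewrite cochain_sum big1 ?addr0 // => k _; rewrite cochainZ mulr0.
rewrite !cochain_cons contract_sum_extmul !(contract_extmul, contract_derive).
rewrite sum_contract_extmul extmulD deriveB deriveZ !cochainD !cochainN IH.
by rewrite !cochainD; ring.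
Qed.

(* The arguments are basis vectors, so neither condition follows from the other. *)
Definition alternating f :=
  (forall p x y s, f (p ++ x :: y :: s) = - f (p ++ y :: x :: s) :> R) /\
  (forall p x s, f (p ++ x :: x :: s) = 0).

Lemma alternating_contract x f : alternating f -> alternating (contract x f).
Proof.
by case=> swapf dupf; split=> p; [apply: (swapf (x :: p)) | apply: (dupf (x :: p))].
Qed.

Lemma alternating0 : alternating 0.
Proof. by split=> *; rewrite ?oppr0. Qed.

Lemma alternatingD f g : alternating f -> alternating g -> alternating (f + g).
Proof.
move=> [swapf dupf] [swapg dupg]; split=> *; rewrite !cochainD.
  by rewrite swapf swapg opprD.
by rewrite dupf dupg addr0.
Qed.

Lemma alternatingZ c f : alternating f -> alternating (c *: f).
Proof.
by move=> [swapf dupf]; split=> *; rewrite !cochainZ ?dupf ?mulr0 // swapf mulrN.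
Qed.

Lemma alternating_unit : alternating unit_cochain.
Proof. by split=> -[|z p] *; rewrite /= ?oppr0. Qed.

Lemma contract_contract x y f :
  alternating f -> contract x (contract y f) = - contract y (contract x f).
Proof. by case=> swapf _; apply/funext => s; apply: (swapf [::]). Qed.

Lemma contract_sqr x f : alternating f -> contract x (contract x f) = 0.
Proof. by case=> _ dupf; apply/funext => s; apply: (dupf [::]). Qed.

Lemma contract2_extmul x y a f :
  contract y (contract x (extmul a f)) =
  (x == a)%:R *: contract y f - (y == a)%:R *: contract x f
  + extmul a (contract y (contract x f)).
Proof.
rewrite -[LHS]/((x == a)%:R *: contract y f - contract y (extmul a (contract x f))).
by rewrite contract_extmul opprD opprK addrA.
Qed.

Lemma alternating_extmul a f : alternating f -> alternating (extmul a f).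
Proof.
move=> altf; split=> p; elim: p f altf => [|z p IH] f altf.
- move=> x y s; rewrite !cochain_cons !contract2_extmul (contract_contract x y altf).
  by rewrite extmulN !cochainD !cochainN; ring.
- move=> x y s; rewrite !cat_cons !(cochain_cons _ z) !contract_extmul.
  rewrite !cochainD !cochainN.
  by rewrite (IH _ (alternating_contract z altf)) !cochainZ (proj1 altf); ring.
- move=> x s; rewrite !cochain_cons contract2_extmul contract_sqr // extmul0 addr0.
  by rewrite subrr.
- move=> x s; rewrite cat_cons cochain_cons contract_extmul !cochainE.
  by rewrite (IH _ (alternating_contract z altf)) (proj2 altf); ring.
Qed.

Lemma alternating_move f a p s :
  alternating f -> f (p ++ a :: s) = (-1) ^+ size p * f (a :: p ++ s) :> R.
Proof.
move=> altf; elim: p f altf => [|x p IH] f altf; first by rewrite mul1r.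
rewrite cat_cons cochain_cons IH; last exact: alternating_contract.
by rewrite exprS mulN1r mulNr -mulrN; congr (_ * _); apply: (proj1 altf [::]).
Qed.

Lemma alternating_dup f a s : alternating f -> a \in s -> f (a :: s) = 0.
Proof.
move=> altf /path.splitPr[p q]; rewrite cochain_cons alternating_move.
  by rewrite [X in _ * X](proj2 altf [::]) mulr0.
exact: alternating_contract.
Qed.

Definition extsum F : cochain := \sum_a extmul a (F a).

Lemma contract_extsum x F :
  contract x (extsum F) = F x - extsum (fun a => contract x (F a)).
Proof. by rewrite contract_sum -[F x]sum_delta -sumrB. Qed.

Lemma extsumN F : extsum (fun a => - F a) = - extsum F.
Proof. by rewrite -sumrN; apply: eq_bigr => a _; rewrite extmulN. Qed.

Lemma extsumB F F' : extsum (fun a => F a - F' a) = extsum F - extsum F'.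
Proof. by rewrite -sumrB; apply: eq_bigr => a _; rewrite extmulB. Qed.

Lemma extsum_nil F : extsum F [::] = 0.
Proof. by rewrite /extsum cochain_sum big1. Qed.

Lemma extsum_nth x0 F s :
  extsum F s = \sum_(j < size s) (-1) ^+ j * F (nth x0 s j) (rm1 s j).
Proof.
elim: s F => [|x s IH] F; first by rewrite extsum_nil big_ord0.
rewrite cochain_cons contract_extsum cochainD cochainN IH [RHS]big_ord_recl mul1r.
rewrite [rm1 _ ord0]/= /rm1 take0 drop1 /= -sumrN; congr (_ + _).
by apply: eq_bigr => j _; rewrite exprS mulN1r mulNr.
Qed.

Lemma extmul_extsum a f : extmul a f = extsum (fun b => (b == a)%:R *: f).
Proof.
rewrite -[LHS](sum_delta a (fun b => extmul b f)).
by apply: eq_bigr => b _; rewrite extmulZ eq_sym.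
Qed.

Lemma derive_extsum m f : alternating f ->
  derive m f = extsum (fun a => \sum_k m k a *: contract k f).
Proof.
move=> altf; apply/funext => s; elim: s f altf => [|x s IH] f altf.
  by rewrite extsum_nil.
rewrite !cochain_cons contract_derive contract_extsum !cochainD cochainN.
rewrite IH; last exact: alternating_contract.
rewrite -[in RHS]cochainN -extsumN; congr (_ + extsum _ s); apply/funext => a.
rewrite contract_sum -sumrN; apply: eq_bigr => k _.
by rewrite contractZ (contract_contract x) // scalerN opprK.
Qed.

Lemma alternating_sum F : (forall k, alternating (F k)) -> alternating (\sum_k F k).
Proof.
by move=> altF; elim/big_ind: _ => //; [apply: alternating0 | apply: alternatingD].
Qed.

Lemma alternating_derive m f : alternating f -> alternating (derive m f).
Proof.
move=> altf; rewrite derive_extsum //; apply: alternating_sum => a.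
apply: alternating_extmul; apply: alternating_sum => k.
exact/alternatingZ/alternating_contract.
Qed.

End Operators.

Arguments unit_cochain {R T}.
Arguments extmul {R T} a f.
Arguments contract {R T} x f : simpl never.

(** * Star operators *)

Section Star.
Variables (R : comNzRingType) (T : finType).
Implicit Types (f g u v : cochain R T) (m : T -> T -> R) (c : R) (a b k x : T).
Implicit Types (s p q : seq T) (D : {pred T}) (n : nat).

Definition star v f : cochain R T :=
  fun s => \sum_(S : {set T}) v (enum S ++ s) * f (enum S).

Lemma star_is_bilinear :
  bilinear_for (GRing.Scale.Law.clone R (cochain R T) *:%R _)
               (GRing.Scale.Law.clone R (cochain R T) *:%R _) star.
Proof.
by split=> h c f g; apply/funext => s;
  rewrite /= cochainD cochainZ /star mulr_sumr -big_split; apply: eq_bigr => S _ /=;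
  rewrite !cochainE; ring.
Qed.

HB.instance Definition _ := bilinear_isBilinear.Build R (cochain R T) (cochain R T)
  (cochain R T) _ _ star star_is_bilinear.

Lemma starNl u f : star (- u) f = - star u f. Proof. exact: linearNl. Qed.

Lemma starDl u v f : star (u + v) f = star u f + star v f. Proof. exact: linearDl. Qed.

Lemma starZl c u f : star (c *: u) f = c *: star u f. Proof. exact: linearZl_LR. Qed.

Lemma star_suml (F : T -> cochain R T) f : star (\sum_k F k) f = \sum_k star (F k) f.
Proof. exact: linear_sumlz. Qed.

Lemma star0r v : star v 0 = 0. Proof. exact: linear0r. Qed.

Lemma starNr v f : star v (- f) = - star v f. Proof. exact: linearNr. Qed.

Lemma starDr v f g : star v (f + g) = star v f + star v g. Proof. exact: linearDr. Qed.

Lemma starBr v f g : star v (f - g) = star v f - star v g. Proof. exact: linearBr. Qed.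

Lemma starZr v c f : star v (c *: f) = c *: star v f. Proof. exact: linearZr_LR. Qed.

Lemma star_sumr v (F : T -> cochain R T) : star v (\sum_k F k) = \sum_k star v (F k).
Proof. exact: linear_sumr. Qed.

Lemma extmul_notin a s f : a \notin s -> extmul a f s = 0.
Proof.
elim: s f => [|x s IH] f //=; rewrite inE negb_or eq_sym => /andP[/negPf-> as'].
by rewrite mul0r sub0r IH // oppr0.
Qed.

Lemma extmul_cat a p q f : a \notin p -> a \notin q ->
  extmul a f (p ++ a :: q) = (-1) ^+ size p * f (p ++ q).
Proof.
elim: p f => [|x p IH] f /= ap aq; first by rewrite eqxx extmul_notin // subr0.
move: ap; rewrite inE negb_or eq_sym => /andP[/negPf-> ap].
by rewrite IH //= exprS mul0r sub0r mulN1r mulNr.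
Qed.

Lemma enum_setE (S : {set T}) : enum S = [seq x <- enum T | x \in S].
Proof. by rewrite [enum T]enumT. Qed.

Lemma enum_setD1_split (S : {set T}) a : a \in S ->
  exists p q, [/\ a \notin p, a \notin q, enum S = p ++ a :: q & enum (S :\ a) = p ++ q].
Proof.
rewrite -mem_enum => aS.
have [p [q Spq]] : exists p q, enum S = p ++ a :: q.
  by case/path.splitPr: aS => p q; exists p, q.
have := enum_uniq S.
rewrite Spq cat_uniq /= => /and3P[_ /norP[ap _] /andP[aq _]].
have filter_notin t : a \notin t -> [seq x <- t | x != a] = t.
  by move=> at'; apply/all_filterP/allP => x xt; apply: contraNneq at' => <-.
exists p, q; split=> //.
have -> : enum (S :\ a) = [seq x <- enum S | x != a].
  by rewrite !enum_setE -[RHS]filter_predI; apply: eq_filter => x; rewrite !inE.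
by rewrite Spq filter_cat /= eqxx !filter_notin.
Qed.

Lemma star_extmul v a f :
  alternating v -> star v (extmul a f) = star (contract a v) f.
Proof.
move=> altv; apply/funext => s; rewrite /star.
rewrite (bigID (fun S : {set T} => a \in S)) /= [X in _ + X]big1 ?addr0; last first.
  by move=> S aS; rewrite extmul_notin ?mulr0 // mem_enum.
rewrite [RHS](bigID (fun S : {set T} => a \in S)) /= [X in X + _]big1 ?add0r; last first.
  move=> S aS; rewrite -cochain_cons alternating_dup ?mul0r //.
  by rewrite mem_cat mem_enum aS.
rewrite [RHS](reindex_onto (fun S => S :\ a) (fun S => a |: S)) /=; last first.
  by move=> S aS; rewrite setU1K.
apply: eq_big => [S|S aS].
  rewrite !inE eqxx /=; apply/idP/eqP => [|<-]; first exact: setD1K.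
  exact: setU11.
have [p [q [ap aq -> ->]]] := enum_setD1_split aS.
rewrite extmul_cat // -catA alternating_move // mulrACA -expr2 sqrr_sign mul1r.
by rewrite catA.
Qed.

Lemma star_unit v : star v unit_cochain = v.
Proof.
apply/funext => s; rewrite /star (bigD1 set0) //= big1 => [|S S0].
  by rewrite enum_set0 mulr1 addr0.
by rewrite /unit_cochain /nilp -cardE cards_eq0 (negPf S0) mulr0.
Qed.

Inductive ext_power D : nat -> cochain R T -> Prop :=
| ext_power_unit : ext_power D 0 unit_cochain
| ext_power_extmul n a f : a \in D -> ext_power D n f -> ext_power D n.+1 (extmul a f)
| ext_power0 n : ext_power D n 0
| ext_powerD n f g : ext_power D n f -> ext_power D n g -> ext_power D n (f + g)
| ext_powerZ n c f : ext_power D n f -> ext_power D n (c *: f).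

Lemma ext_power_alternating D n f : ext_power D n f -> alternating f.
Proof.
elim=> *.
- exact: alternating_unit.
- exact: alternating_extmul.
- exact: alternating0.
- exact: alternatingD.
- exact: alternatingZ.
Qed.

Lemma ext_powerN D n f : ext_power D n f -> ext_power D n (- f).
Proof. by rewrite -scaleN1r; apply: ext_powerZ. Qed.

Lemma ext_powerB D n f g : ext_power D n f -> ext_power D n g -> ext_power D n (f - g).
Proof. by move=> Df Dg; apply: ext_powerD (ext_powerN Dg). Qed.

Lemma derive_extmul0 m a f :
  (forall k, m a k = 0) -> derive m (extmul a f) = extmul a (derive m f).
Proof.
by move=> ma0; rewrite derive_extmul big1 ?add0r // => k _; rewrite ma0 scale0r.
Qed.

Lemma derive_ext_power0 D n m f :
  {in D, forall a k, m a k = 0} -> ext_power D n f -> derive m f = 0.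
Proof.
move=> mD; elim=> {n f} [|n a f aD _ IH|n|n f g _ IHf _ IHg|n c f _ IH].
- exact: derive_unit.
- by rewrite derive_extmul0 ?IH ?extmul0 //; apply: mD.
- exact: derive0.
- by rewrite deriveD IHf IHg addr0.
- by rewrite deriveZ IH scaler0.
Qed.

Lemma ext_power_derive D n m f :
  {in D, forall a k, k \notin D -> m a k = 0} -> ext_power D n f ->
  ext_power D n (derive m f).
Proof.
move=> mD; elim=> {n f} [|n a f aD Df IH|n|n f g _ IHf _ IHg|n c f _ IH].
- by rewrite derive_unit; apply: ext_power0.
- rewrite derive_extmul; apply: ext_powerD; last exact: ext_power_extmul.
  elim/big_ind: _ => [||k _]; [exact: ext_power0 | exact: ext_powerD |].
  have [kD|kD] := boolP (k \in D); first exact/ext_powerZ/ext_power_extmul.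
  by rewrite mD // scale0r; apply: ext_power0.
- by rewrite derive0; apply: ext_power0.
- by rewrite deriveD; apply: ext_powerD.
- by rewrite deriveZ; apply: ext_powerZ.
Qed.

(* [derive m] acts on [star v f] through the arguments of [v] that are not paired
   with [f]; acting on the paired ones is acting on [f] by the transpose. *)
Lemma star_derive D n m v f : ext_power D n f -> alternating v ->
  star v (derive (fun k j => m j k) f) = star (derive m v) f - derive m (star v f).
Proof.
move=> Df.
elim: Df v => {n f}
  [v _|n a f _ _ IH v altv|n v _|n f g _ IHf _ IHg v altv|n c f _ IH v altv].
- by rewrite !star_unit derive_unit star0r subrr.
- have altdv : alternating (derive m v) by apply: alternating_derive.
  rewrite derive_extmul starDr star_sumr !star_extmul // IH; last first.
    exact: alternating_contract.
  rewrite contract_derive starDl star_suml -addrA; congr (_ + _).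
  by apply: eq_bigr => k _; rewrite starZl starZr star_extmul.
- by rewrite !(derive0, star0r) subrr.
- by rewrite deriveD !starDr deriveD IHf // IHg // opprD addrACA.
- by rewrite deriveZ !starZr deriveZ IH // scalerBr.
Qed.

Lemma star_extmull D n a v f : a \notin D -> ext_power D n f -> alternating v ->
  star (extmul a v) f = (-1) ^+ n *: extmul a (star v f).
Proof.
move=> aD Df; elim: Df v => {n f}.
- by move=> v _; rewrite !star_unit scale1r.
- move=> n b f bD _ IH v altv.
  rewrite !star_extmul //; last exact: alternating_extmul.
  rewrite contract_extmul (negPf (memPn aD b bD)) scale0r sub0r starNl.
  rewrite IH; last exact: alternating_contract.
  by rewrite exprS mulN1r scaleNr.
- by move=> n v _; rewrite !star0r extmul0 scaler0.
- move=> n f g _ IHf _ IHg v altv.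
  by rewrite !starDr extmulD scalerDr IHf // IHg.
- by move=> n c f _ IH v altv; rewrite !starZr extmulZ IH // !scalerA mulrC.
Qed.

End Star.

(** * Basis forms *)

Section Basis.
Variables (R : comNzRingType) (T : finType).
Implicit Types (f v : cochain R T) (m : T -> T -> R) (c : R) (a b k x : T).
Implicit Types (s p q I J K L : seq T) (D : {pred T}) (n : nat).

Definition extmuls I f : cochain R T := foldr extmul f I.

Lemma extmuls_is_linear I : linear (extmuls I).
Proof. by move=> c f g; elim: I => //= a I ->; rewrite linearP. Qed.

HB.instance Definition _ I := GRing.isLinear.Build R (cochain R T) (cochain R T) _
  (extmuls I) (extmuls_is_linear I).

Lemma extmulsN I f : extmuls I (- f) = - extmuls I f. Proof. exact: linearN. Qed.

Lemma extmulsD I f g : extmuls I (f + g) = extmuls I f + extmuls I g.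
Proof. exact: linearD. Qed.

Lemma extmulsZ I c f : extmuls I (c *: f) = c *: extmuls I f. Proof. exact: linearZ. Qed.

Lemma extmuls_cons a I f : extmuls (a :: I) f = extmul a (extmuls I f).
Proof. by []. Qed.

Lemma extmuls_cat I J f : extmuls (I ++ J) f = extmuls I (extmuls J f).
Proof. exact: foldr_cat. Qed.

Lemma extmuls_move p a q f :
  extmuls (p ++ a :: q) f = (-1) ^+ size p *: extmul a (extmuls (p ++ q) f).
Proof.
elim: p => [|x p IH]; first by rewrite scale1r.
by rewrite cat_cons extmuls_cons IH extmulZ extmul_anticomm scalerN exprS mulN1r scaleNr.
Qed.

Lemma extmul_extmuls_mem a I f : a \in I -> extmul a (extmuls I f) = 0.
Proof. by case/path.splitPr=> p q; rewrite extmuls_move extmulZ extmul_sqr scaler0. Qed.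

Lemma derive_extmuls m K f : uniq K -> {in K, forall a k, k \notin K -> m a k = 0} ->
  derive m (extmuls K f) = (\sum_(a <- K) m a a) *: extmuls K f + extmuls K (derive m f).
Proof.
move=> uK mK; suff leibniz J L : L ++ J = K ->
    extmuls L (derive m (extmuls J f)) =
    (\sum_(a <- J) m a a) *: extmuls K f + extmuls K (derive m f).
  exact: (leibniz K [::]).
elim: J L => [|a J IH] L LJK; first by rewrite -LJK cats0 big_nil scale0r add0r.
rewrite extmuls_cons derive_extmul linearD linear_sum big_cons scalerDl -addrA /=.
congr (_ + _); last by rewrite -(IH (rcons L a)) ?cat_rcons // -cats1 extmuls_cat.
rewrite (bigD1 a) //= linearZ /= -extmuls_cons -extmuls_cat LJK big1 ?addr0 // => k ka.
(* An off-diagonal term repeats a factor. *)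
have [kK|kK] := boolP (k \in K); last first.
  by rewrite (mK a) ?scale0r ?linear0 // -LJK mem_cat mem_head orbT.
rewrite linearZ /= -extmuls_cons -extmuls_cat extmuls_move extmul_extmuls_mem ?scaler0 //.
by move: kK; rewrite -LJK !mem_cat inE (negPf ka).
Qed.

Definition basis_cochain I : cochain R T := extmuls I unit_cochain.

Lemma basis_cons a I : basis_cochain (a :: I) = extmul a (basis_cochain I).
Proof. by []. Qed.

Lemma basis_move p a q :
  basis_cochain (p ++ a :: q) = (-1) ^+ size p *: extmul a (basis_cochain (p ++ q)).
Proof. exact: extmuls_move. Qed.

Lemma ext_power_basis D I : all (mem D) I -> ext_power D (size I) (basis_cochain I).
Proof.
elim: I => [|a I IH] /=; first by move=> _; apply: ext_power_unit.
by case/andP=> aD /IH DI; apply: ext_power_extmul.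
Qed.

Lemma alternating_basis I : alternating (basis_cochain I).
Proof. by apply: ext_power_alternating (@ext_power_basis predT I _); apply/allP. Qed.

Lemma contract_basis_notin x I : x \notin I -> contract x (basis_cochain I) = 0.
Proof.
elim: I => [|a I IH]; first by rewrite [LHS]contract_unit.
rewrite inE negb_or => /andP[/negPf xa xI].
by rewrite basis_cons contract_extmul xa scale0r IH // extmul0 subr0.
Qed.

Lemma contract_basis x I : uniq I -> x \in I ->
  contract x (basis_cochain I) = (-1) ^+ index x I *: basis_cochain (rem x I).
Proof.
elim: I => // a I IH; rewrite cons_uniq => /andP[aI uI].
rewrite basis_cons contract_extmul inE (eq_sym x a) /=.
case: (eqVneq a x) => [<- _|_ /= xI].
  by rewrite contract_basis_notin // extmul0 subr0 scale1r.
by rewrite IH // extmulZ scale0r sub0r exprS mulN1r scaleNr.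
Qed.

Lemma basis_notin_eq0 I x s : x \in s -> x \notin I -> basis_cochain I s = 0.
Proof.
case/path.splitPr=> p q xI; rewrite (alternating_move _ _ _ (alternating_basis I)).
by rewrite cochain_cons contract_basis_notin // mulr0.
Qed.

Lemma star_extmuls2l D n a b v f :
  a \notin D -> b \notin D -> ext_power D n f -> alternating v ->
  star (extmuls [:: a; b] v) f = extmuls [:: a; b] (star v f).
Proof.
move=> aD bD Df altv; rewrite /= (star_extmull aD Df); last exact: alternating_extmul.
rewrite (star_extmull bD Df) // extmulZ scalerA -exprD -signr_odd.
by rewrite addnn odd_double scale1r.
Qed.

Lemma star_basis_extmul K a f : uniq K -> a \in K ->
  star (basis_cochain K) (extmul a f) =
  (-1) ^+ index a K *: star (basis_cochain (rem a K)) f.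
Proof.
by move=> uK aK; rewrite star_extmul ?contract_basis ?starZl //; apply: alternating_basis.
Qed.

Lemma star_basis_cons K a I : uniq K -> a \in K ->
  star (basis_cochain K) (basis_cochain (a :: I)) =
  (-1) ^+ index a K *: star (basis_cochain (rem a K)) (basis_cochain I).
Proof. exact: star_basis_extmul. Qed.

Lemma star_basis_nil v : star v (basis_cochain [::]) = v.
Proof. exact: star_unit. Qed.

End Basis.

Arguments basis_cochain R {T} I : simpl never.

(** * The Chevalley-Eilenberg differential *)

Section Differential.
Variable R : comNzRingType.
Local Notation form := (cochain R 'I_7).
Implicit Types (f g : form) (h : 'I_7 -> 'I_7 -> form) (s : seq 'I_7).

Lemma rm2_cons0 x s j : rm2 (x :: s) 0 j.+1 = rm1 s j.
Proof. by rewrite (rm1E ord0) /rm2 /= (iotaDl 1 0) filter_map -map_comp. Qed.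

Lemma rm2_consS x s i j : rm2 (x :: s) i.+1 j.+1 = x :: rm2 s i j.
Proof. by rewrite /rm2 /= (iotaDl 1 0) filter_map -map_comp. Qed.

Definition altsum2 h : form := fun s =>
  \sum_(i < size s) \sum_(j < size s | (i < j)%N)
    (-1) ^+ (i + j) * h (nth ord0 s i) (nth ord0 s j) (rm2 s i j).

Lemma contract_altsum2 x h :
  contract x (altsum2 h) = altsum2 (fun a b => contract x (h a b)) - extsum (h x).
Proof.
apply/funext => s; rewrite cochainD cochainN (extsum_nth ord0) /contract /altsum2 /=.
rewrite big_ord_recl big_mkcond /= big_ord_recl /= add0r addrC; congr (_ + _).
  apply: eq_bigr => i _; rewrite big_mkcond big_ord_recl /= add0r [RHS]big_mkcond.
  apply: eq_bigr => j _; rewrite /= /bump !add1n ltnS; case: ifP => // _.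
  by rewrite rm2_consS addnS addSn 2!exprS mulN1r mulN1r opprK.
rewrite -sumrN; apply: eq_bigr => j _.
by rewrite /bump !add1n /= add0n exprS rm2_cons0 mulN1r mulNr.
Qed.

Lemma altsum2_extsum h :
  altsum2 (fun a b => h a b - h b a) = - extsum (fun a => extsum (h a)).
Proof.
apply/funext => s; rewrite cochainN; elim: s h => [|x s IH] h.
  by rewrite extsum_nil oppr0 /altsum2 big_ord0.
rewrite !cochain_cons contract_altsum2 contract_extsum extsumB !cochainD !cochainN.
have -> : (fun a => contract x (extsum (h a))) =
    (fun a => h a x - extsum (fun b => contract x (h a b))).
  by apply/funext => a; rewrite contract_extsum.
rewrite (IH (fun a b => contract x (h a b))) extsumB !cochainD !cochainN; ring.
Qed.

(* Bracketing with [p i] in the first slot of [f] and alternating over the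
   arguments amounts to acting with [p i] on every slot, since [f] alternates. *)
Lemma dform_derive (p : 'I_7 -> 'I_7 -> 'I_7 -> R) f : alternating f ->
  dform (fun k i j => p i j k - p j i k) f =
  - extsum (fun a => derive (fun k j => p a j k) f).
Proof.
move=> altf; pose h a b := \sum_k p a b k *: contract k f.
have -> : (fun a => derive (fun k j => p a j k) f) = (fun a => extsum (h a)).
  by apply/funext => a; rewrite derive_extsum.
rewrite -altsum2_extsum; apply/funext => s.
apply: eq_bigr => i _; apply: eq_bigr => j _; congr (_ * _).
rewrite /h !cochainE -sumrB; apply: eq_bigr => k _.
by rewrite mulrBl !cochainE.
Qed.

Section Linearity.
Variable c : 'I_7 -> 'I_7 -> 'I_7 -> R.
Local Notation d := (dform c : form -> form).

Lemma dform_is_linear : linear d.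
Proof.
move=> u f g; apply/funext => s; rewrite cochainD cochainZ /dform.
rewrite mulr_sumr -big_split; apply: eq_bigr => i _ /=.
rewrite mulr_sumr -big_split; apply: eq_bigr => j _ /=.
rewrite mulrCA -mulrDr; congr (_ * _); rewrite mulr_sumr -big_split.
by apply: eq_bigr => k _ /=; rewrite cochainD cochainZ; ring.
Qed.

HB.instance Definition _ := GRing.isLinear.Build R form form _ d dform_is_linear.

Lemma dformN f : d (- f) = - d f. Proof. exact: linearN. Qed.

Lemma dformD f g : d (f + g) = d f + d g. Proof. exact: linearD. Qed.

Lemma dformB f g : d (f - g) = d f - d g. Proof. exact: linearB. Qed.

Lemma dformZ u f : d (u *: f) = u *: d f. Proof. exact: linearZ. Qed.

End Linearity.

End Differential.

(** * Wedge product with a basis form *)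

Definition cons_set n (b : bool) (S : {set 'I_n}) : {set 'I_n.+1} :=
  [set i | if unlift ord0 i is Some j then j \in S else b].

Lemma in_cons_set0 n b (S : {set 'I_n}) : (ord0 \in cons_set b S) = b.
Proof. by rewrite inE unlift_none. Qed.

Lemma in_cons_setS n b (S : {set 'I_n}) j : (lift ord0 j \in cons_set b S) = (j \in S).
Proof. by rewrite inE liftK. Qed.

Lemma enum_cons_set n b (S : {set 'I_n}) :
  enum (cons_set b S) = nseq b ord0 ++ map (lift ord0) (enum S).
Proof.
rewrite !enum_setE enum_ordSl /= in_cons_set0 filter_map (eq_filter (a2 := mem S)).
  by case: b.
by move=> j /=; rewrite in_cons_setS.
Qed.

Lemma setC_cons_set n b (S : {set 'I_n}) : ~: cons_set b S = cons_set (~~ b) (~: S).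
Proof. by apply/setP => i; rewrite !inE; case: unliftP => [j|] _; rewrite ?inE. Qed.

Lemma big_cons_set (V : nmodType) n (F : {set 'I_n.+1} -> V) :
  \sum_S F S = \sum_(S : {set 'I_n}) F (cons_set true S) +
               \sum_(S : {set 'I_n}) F (cons_set false S).
Proof.
pose uncons_set (S : {set 'I_n.+1}) := (ord0 \in S, [set j | lift ord0 j \in S]).
rewrite (reindex (fun bS => cons_set bS.1 bS.2)) /=; last first.
  exists uncons_set => [[b S] _|S _].
    by congr pair; [apply: in_cons_set0 | apply/setP => j; rewrite inE in_cons_setS].
  by apply/setP => i; rewrite !inE /=; case: unliftP => [j|] ->; rewrite ?inE.
by rewrite -(pair_bigA _ (fun b S => F (cons_set b S))) big_bool.
Qed.

Lemma shufE n (S : {set 'I_n}) :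
  shuf S = (\sum_(i < n) \sum_(j < n) ((i \in S) && (j \notin S) && (j < i)))%N.
Proof.
rewrite /shuf -sum1_card big_mkcond pair_bigA /=.
by apply: eq_bigr => p _; rewrite inE; case: ifP.
Qed.

Lemma shuf_cons_set n b (S : {set 'I_n}) :
  shuf (cons_set b S) = (shuf S + ~~ b * #|S|)%N.
Proof.
rewrite !shufE big_ord_recl big1 ?add0n; last by move=> j _; rewrite ltn0 andbF.
under eq_bigr do rewrite big_ord_recl in_cons_set0 in_cons_setS /= andbT.
rewrite big_split /= addnC; congr addn.
  by apply: eq_bigr => i _; apply: eq_bigr => j _; rewrite in_cons_setS.
rewrite -sum1_card big_distrr [RHS]big_mkcond /=; apply: eq_bigr => i _.
by case: (i \in S); case: b.
Qed.

Section Wedge.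
Variable R : comNzRingType.
Local Notation form := (cochain R 'I_7).
Local Notation wedge := (@wedge R : form -> form -> form).
Implicit Types (f g h : form) (c : R) (s : seq 'I_7).

Definition grade_inv f : form := fun s => (-1) ^+ size s * f s.

Lemma grade_inv_is_linear : linear grade_inv.
Proof. by move=> c f g; apply/funext => s; rewrite /grade_inv !cochainE; ring. Qed.

HB.instance Definition _ :=
  GRing.isLinear.Build R form form _ grade_inv grade_inv_is_linear.

Lemma contract_grade_inv x f : contract x (grade_inv f) = - grade_inv (contract x f).
Proof.
by apply/funext => s; rewrite cochainN /contract /grade_inv /= exprS mulN1r mulNr.
Qed.

Lemma grade_invK : involutive grade_inv.
Proof.
by move=> f; apply/funext => s; rewrite /grade_inv mulrA -expr2 sqrr_sign mul1r.
Qed.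

Lemma grade_inv_extmul a f : grade_inv (extmul a f) = - extmul a (grade_inv f).
Proof.
apply/funext => s; rewrite cochainN; elim: s f => [|x s IH] f.
  by rewrite /grade_inv mulr0 oppr0.
rewrite !cochain_cons contract_grade_inv !contract_extmul linearB linearZ /=.
by rewrite contract_grade_inv extmulN !cochainE IH; ring.
Qed.

Lemma grade_inv_ext_power D n f : ext_power D n f -> grade_inv f = (-1) ^+ n *: f.
Proof.
elim=> {n f} [|n a f _ _ IH|n|n f g _ IHf _ IHg|n c f _ IH].
- by apply/funext => -[|x s]; rewrite /grade_inv !cochainE ?mulr0.
- by rewrite grade_inv_extmul IH extmulZ exprS mulN1r scaleNr.
- by rewrite linear0 scaler0.
- by rewrite linearD scalerDr /= IHf IHg.
- by rewrite linearZ /= IH !scalerA mulrC.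
Qed.

Lemma subt_cons_set x s b (S : {set 'I_(size s)}) :
  @subt (x :: s) (cons_set b S) = nseq b x ++ subt S.
Proof. by rewrite /subt enum_cons_set map_cat map_nseq -map_comp. Qed.

Lemma wedgeNl f g : wedge (- f) g = - wedge f g.
Proof.
apply/funext => s; rewrite cochainN -sumrN; apply: eq_bigr => S _.
by rewrite cochainN mulrN mulNr.
Qed.

Lemma wedgeZr f c g : wedge f (c *: g) = c *: wedge f g.
Proof.
by apply/funext => s; rewrite cochainZ mulr_sumr; apply: eq_bigr => S _; apply: mulrCA.
Qed.

Lemma wedgeBr f g h : wedge f (g - h) = wedge f g - wedge f h.
Proof.
apply/funext => s; rewrite cochainD cochainN -sumrB; apply: eq_bigr => S _.
by rewrite -mulrBr.
Qed.

Lemma contract_wedge x f g :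
  contract x (wedge f g) = wedge (contract x f) g + wedge (grade_inv f) (contract x g).
Proof.
apply/funext => s; rewrite cochainD /contract /wedge big_cons_set.
congr (_ + _); apply: eq_bigr => S _; rewrite shuf_cons_set setC_cons_set !subt_cons_set.
  by rewrite /= mul0n addn0.
by rewrite /= mul1n exprD /grade_inv {3}/subt size_map -cardE mulrA.
Qed.

Lemma wedge_nil f g : wedge f g [::] = f [::] * g [::].
Proof.
rewrite /wedge (big_pred1 set0) => [|S]; last first.
  by apply/esym/eqP/setP => -[].
have subt_nil (S : {set 'I_(@size 'I_7 [::])}) : subt S = [::].
  apply: size0nil; rewrite size_map -cardE; apply/eqP.
  by rewrite -leqn0 -[leqRHS]card_ord max_card.
by rewrite shufE big_ord0 mul1r !subt_nil.
Qed.

Lemma wedge_extmul f a g : wedge f (extmul a g) = extmul a (wedge (grade_inv f) g).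
Proof.
apply/funext => s; elim: s f g => [|x s IH] f g; first by rewrite wedge_nil mulr0.
rewrite !cochain_cons !contract_extmul !contract_wedge contract_grade_inv grade_invK.
rewrite wedgeBr wedgeZr wedgeNl extmulD extmulN !cochainE !IH grade_invK.
ring.
Qed.

Lemma wedge_unit f : wedge f unit_cochain = f.
Proof.
apply/funext => s; elim: s f => [|x s IH] f; first by rewrite wedge_nil mulr1.
rewrite !cochain_cons contract_wedge contract_unit cochainD IH.
by rewrite [X in _ + X]big1 ?addr0 // => S _; apply: mulr0.
Qed.

Lemma wedge_basis f I :
  wedge f (basis_cochain R I) = extmuls I (iter (size I) grade_inv f).
Proof.
elim: I f => [|a I IH] f; first exact: wedge_unit.
by rewrite basis_cons wedge_extmul IH -iterSr.
Qed.

Lemma wedge_basis_even D n f I :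
  ext_power D n f -> ~~ odd n -> wedge f (basis_cochain R I) = extmuls I f.
Proof.
move=> Df n_even; rewrite wedge_basis; congr extmuls.
elim: (size I) => //= k ->; rewrite (grade_inv_ext_power Df).
by rewrite -signr_odd (negPf n_even) scale1r.
Qed.

Lemma eb_nil : eb R [::] = unit_cochain.
Proof. by apply/funext => -[|x s] //; rewrite /eb /= det_mx00. Qed.

Lemma eb_cons a I : eb R (a :: I) = extmul a (eb R I).
Proof.
apply/funext => s; rewrite extmul_extsum (extsum_nth ord0).
have [sI|sI] := eqVneq (size s) (size I).+1; last first.
  rewrite /eb /= (negPf sI) big1 // => j _; rewrite cochainZ size_rm1 //.
  by rewrite -eqSS prednK ?(negPf sI) ?mulr0 // (leq_ltn_trans _ (ltn_ord j)).
rewrite [LHS]/eb sI eqxx (expand_det_col _ ord0); apply: eq_bigr => j _.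
have js : (j < size s)%N by rewrite sI.
rewrite mxE /cofactor addn0 cochainZ mulrCA /eb size_rm1 // sI eqxx.
by congr (_ * (_ * \det _)); apply/matrixP => b c; rewrite !mxE nth_rm1.
Qed.

Lemma ebE I : eb R I = basis_cochain R I.
Proof. by elim: I => [|a I IH]; rewrite ?eb_nil // eb_cons IH. Qed.

End Wedge.

(** * The Lie algebra and its forms *)

Local Notation e1 := (@Ordinal 7 0 isT).
Local Notation e2 := (@Ordinal 7 1 isT).
Local Notation e3 := (@Ordinal 7 2 isT).
Local Notation e4 := (@Ordinal 7 3 isT).
Local Notation e5 := (@Ordinal 7 4 isT).
Local Notation e6 := (@Ordinal 7 5 isT).
Local Notation e7 := (@Ordinal 7 6 isT).

Lemma inord7 : (inord 0 = e1) * (inord 1 = e2) * (inord 2 = e3) * (inord 3 = e4) *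
  (inord 4 = e5) * (inord 5 = e6) * (inord 6 = e7).
Proof. by do !split; apply: val_inj; rewrite /= inordK. Qed.

Section FormOperations.
Variable R : comNzRingType.
Implicit Types (f g : cochain R 'I_7).

Lemma faddE f g : fadd f g = f + g. Proof. by []. Qed.

Lemma fsubE f g : fsub f g = f - g. Proof. by []. Qed.

Lemma fscaleE c f : fscale c f = c *: f. Proof. by []. Qed.

Definition formE := (faddE, fsubE, fscaleE).

Lemma eeE (l : seq nat) :
  ee R l = basis_cochain R [seq inord i.-1 | i <- l].
Proof. exact: ebE. Qed.

End FormOperations.

Section G2.
Variable R : comNzRingType.
Local Notation form := (cochain R 'I_7).
Local Notation theta := (@Defs.theta R : 'M[R]_4 -> form -> form).
Local Notation hodge := (@Defs.hodge R : form -> form).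
Local Notation hodge_g1 := (@Defs.hodge_g1 R : form -> form).
Local Notation vol_g1 := (Defs.vol_g1 R : form).
Local Notation phi0 := (@Defs.phi0 R : form).
Local Notation omega7 := (@Defs.omega7 R : form).
Local Notation omega1 := (@Defs.omega1 R : form).
Local Notation omega2 := (@Defs.omega2 R : form).
Implicit Types (f g : form) (M : 'M[R]_4) (s : seq 'I_7) (n : nat).

Lemma basis_neq_size_eq0 I s : size s != size I -> basis_cochain R I s = 0.
Proof. by move=> sI; rewrite -ebE /eb (negPf sI). Qed.

Lemma hodge_star f : hodge f = star (vol R) f.
Proof.
apply/funext => s; rewrite /Defs.hodge big_mkcond; apply: eq_bigr => S _.
case: ifP => [_|sz]; first exact: mulrC.
by rewrite /vol ebE basis_neq_size_eq0 ?mul0r // size_cat -cardE size_enum_ord sz.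
Qed.

Lemma vol_g1E : vol_g1 = basis_cochain R [:: e3; e4; e5; e6].
Proof. by rewrite /Defs.vol_g1 !eeE /= !inord7. Qed.

Lemma hodge_g1_star f : hodge_g1 f = star vol_g1 f.
Proof.
apply/funext => s; rewrite /Defs.hodge_g1 big_mkcond vol_g1E; apply: eq_bigr => S _.
case: ifP => [_|/negbT]; first exact: mulrC.
rewrite negb_and => /orP[/subsetPn[x xS xg1]|sz]; last first.
  by rewrite basis_neq_size_eq0 ?mul0r // size_cat -cardE.
rewrite (@basis_notin_eq0 _ _ _ x) ?mul0r ?mem_cat ?mem_enum ?xS //.
by apply: contraNN xg1; rewrite !inE => /or4P[]/eqP->.
Qed.

Lemma theta_derive M f : theta M f = - derive (extg1 M) f.
Proof. by apply/funext => s; rewrite cochainN (derive_nth ord0). Qed.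

Definition ext12 (A1 : 'M[R]_2) (k j : 'I_7) : R :=
  if (j < 2)%N && (k < 2)%N then A1 (i2 k) (i2 j) else 0.

Lemma sum7 (V : nmodType) (F : 'I_7 -> V) :
  \sum_k F k = F e1 + F e2 + F e3 + F e4 + F e5 + F e6 + F e7.
Proof.
rewrite !big_ord_recl big_ord0 addr0 !addrA.
by do ![congr (_ + _)]; congr F; apply: val_inj.
Qed.

Lemma dform_sc (A1 : 'M[R]_2) (A B C : 'M[R]_4) f : alternating f ->
  dform (sc A1 A B C) f =
  extmul e7 (theta A f - derive (ext12 A1) f)
  + extmul e1 (theta B f) + extmul e2 (theta C f).
Proof.
move=> altf; rewrite (dform_derive (adp A1 A B C) altf) /extsum sum7 !theta_derive.
have ad_e1 : (fun k j => adp A1 A B C e1 j k) = extg1 B.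
  by apply/funext => k; apply/funext => j; rewrite /adp /extg1 /= andbC.
have ad_e2 : (fun k j => adp A1 A B C e2 j k) = extg1 C.
  by apply/funext => k; apply/funext => j; rewrite /adp /extg1 /= andbC.
have ad_e7 : (fun k j => adp A1 A B C e7 j k) =
    (fun k j => ext12 A1 k j + extg1 A k j).
  apply/funext => k; apply/funext => j; rewrite /adp /ext12 /extg1 /= [in_g1 j && _]andbC.
  case: ifP => [/andP[_ k2]|_]; last by rewrite add0r.
  by rewrite {1}/in_g1 leqNgt k2 addr0.
rewrite ad_e1 ad_e2 ad_e7 /adp /= derivem0 derivemD !extmul_linear.
by rewrite !addr0; apply/funext => s; rewrite !cochainE; ring.
Qed.

Lemma ext_power_theta M n f : ext_power in_g1 n f -> ext_power in_g1 n (theta M f).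
Proof.
move=> g1f; rewrite theta_derive; apply/ext_powerN/ext_power_derive => // a _ k kg1.
by rewrite /extg1 (negPf kg1 : in_g1 k = false) andbF.
Qed.

Lemma theta_extmul M a f :
  ~~ in_g1 a -> theta M (extmul a f) = extmul a (theta M f).
Proof.
move=> ag1; rewrite !theta_derive derive_extmul0 ?extmulN // => k.
by rewrite /extg1 (negPf ag1).
Qed.

Lemma derive_ext12_g1 (A1 : 'M[R]_2) n f : ext_power in_g1 n f -> derive (ext12 A1) f = 0.
Proof.
apply: derive_ext_power0 => a /andP[a2 _] k.
by rewrite /ext12 [(a < 2)%N]ltnNge a2 andbF.
Qed.

Lemma derive_ext12_e12 (A1 : 'M[R]_2) n f : ext_power in_g1 n f ->
  derive (ext12 A1) (extmuls [:: e1; e2] f) = \tr A1 *: extmuls [:: e1; e2] f.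
Proof.
move=> g1f; rewrite derive_extmuls //; last first.
  by move=> a; rewrite !inE => /orP[]/eqP-> k; rewrite !inE /ext12; case: k => -[|[|k]].
rewrite (derive_ext12_g1 _ g1f) linear0 addr0; congr (_ *: _).
rewrite !big_cons big_nil addr0 /mxtrace !big_ord_recl big_ord0 addr0 /ext12 /=.
by congr (A1 _ _ + A1 _ _); apply: val_inj; rewrite /= inordK.
Qed.

Lemma derive_extg1_vol_g1 M : derive (extg1 M) vol_g1 = \tr M *: vol_g1.
Proof.
rewrite vol_g1E derive_extmuls // ?derive_unit ?linear0 ?addr0; last first.
  move=> a _ k kg1; rewrite /extg1; case: ifP => // /andP[_]; move: kg1.
  by rewrite !inE /in_g1; case: k => -[|[|[|[|[|[|k]]]]]].
congr (_ *: _).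
rewrite !big_cons big_nil addr0 /mxtrace !big_ord_recl big_ord0 addr0 /extg1 /=.
by congr (M _ _ + (M _ _ + (M _ _ + M _ _))); apply: val_inj; rewrite /= inordK.
Qed.

Section Differential.
Variables (A1 : 'M[R]_2) (A B C : 'M[R]_4).
Local Notation d := (dform (sc A1 A B C) : form -> form).

Lemma dform_g1 n f : ext_power in_g1 n f ->
  d f = extmul e7 (theta A f) + extmul e1 (theta B f) + extmul e2 (theta C f).
Proof.
move=> g1f; rewrite dform_sc; last exact: ext_power_alternating g1f.
by rewrite (derive_ext12_g1 _ g1f) subr0.
Qed.

Lemma dform_e12 n f : ext_power in_g1 n f ->
  d (extmuls [:: e1; e2] f) = extmuls [:: e1; e2; e7] (theta A f - \tr A1 *: f).
Proof.
move=> g1f; rewrite dform_sc; last first.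
  by do 2!apply: alternating_extmul; apply: ext_power_alternating g1f.
rewrite (derive_ext12_e12 _ g1f) !theta_extmul // extmul_sqr extmul_sandwich.
by rewrite !addr0 /= -!extmulZ -!extmulB [LHS]extmul_cycle.
Qed.

Lemma dform_e7 f : alternating f ->
  d (extmul e7 f) = extmuls [:: e1; e7] (theta B f) + extmuls [:: e2; e7] (theta C f).
Proof.
move=> altf; rewrite dform_sc; last exact: alternating_extmul.
rewrite derive_extmul0 => [|k]; last by rewrite /ext12 andbF.
by rewrite !theta_extmul // -extmulB extmul_sqr add0r.
Qed.

Lemma dform_e27 n f : ext_power in_g1 n f ->
  d (extmuls [:: e2; e7] f) = extmuls [:: e1; e2; e7] (theta B f).
Proof.
move=> g1f; rewrite /= (extmul_anticomm e2) dformN dform_e7; last first.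
  exact/alternating_extmul/ext_power_alternating/g1f.
rewrite !theta_extmul //=.
by rewrite extmul_sandwich addr0 (extmul_anticomm e7) extmulN opprK.
Qed.

Lemma dform_e17 n f : ext_power in_g1 n f ->
  d (extmuls [:: e1; e7] f) = - extmuls [:: e1; e2; e7] (theta C f).
Proof.
move=> g1f; rewrite /= (extmul_anticomm e1) dformN dform_e7; last first.
  exact/alternating_extmul/ext_power_alternating/g1f.
by rewrite !theta_extmul // /= extmul_sandwich add0r -(extmul_cycle e1).
Qed.

End Differential.

Lemma volE : vol R = basis_cochain R [:: e1; e2; e3; e4; e5; e6; e7].
Proof.
by rewrite /vol ebE; congr basis_cochain; apply: (inj_map val_inj); rewrite val_enum_ord.
Qed.

Lemma basis_e34567 :
  basis_cochain R [:: e3; e4; e5; e6; e7] =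
  extmul e7 (basis_cochain R [:: e3; e4; e5; e6]).
Proof. by rewrite (basis_move _ [:: e3; e4; e5; e6] e7 [::]) -signr_odd scale1r. Qed.

Lemma hodge_e127 f : hodge (extmuls [:: e1; e2; e7] f) = hodge_g1 f.
Proof.
rewrite hodge_star hodge_g1_star volE vol_g1E /= !star_basis_extmul //=.
by rewrite !scalerA -!exprD -signr_odd scale1r.
Qed.

Lemma hodge_g1_theta M n f : ext_power in_g1 n f ->
  hodge_g1 (theta M f) = - (\tr M *: hodge_g1 f + theta M^T (hodge_g1 f)).
Proof.
move=> g1f; rewrite !hodge_g1_star !theta_derive.
have -> : extg1 M = (fun k j => extg1 M^T j k).
  by apply/funext => k; apply/funext => j; rewrite /extg1 mxE andbC.
rewrite starNr (star_derive _ g1f); last by rewrite vol_g1E; apply: alternating_basis.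
by rewrite derive_extg1_vol_g1 mxtrace_tr starZl.
Qed.

Lemma omega7E :
  omega7 = basis_cochain R [:: e3; e4] + basis_cochain R [:: e5; e6].
Proof. by rewrite /Defs.omega7 !eeE /= !inord7. Qed.

Lemma omega1E :
  omega1 = basis_cochain R [:: e3; e5] - basis_cochain R [:: e4; e6].
Proof. by rewrite /Defs.omega1 !eeE /= !inord7. Qed.

Lemma omega2E :
  omega2 = - basis_cochain R [:: e3; e6] - basis_cochain R [:: e4; e5].
Proof.
rewrite -[X in X - _]scaleN1r.
by rewrite /Defs.omega2 !eeE /= !inord7.
Qed.

Lemma ext_power_omega7 : ext_power in_g1 2 omega7.
Proof.
rewrite omega7E; apply: ext_powerD.
  exact: (@ext_power_basis _ _ in_g1 [:: e3; e4]).
exact: (@ext_power_basis _ _ in_g1 [:: e5; e6]).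
Qed.

Lemma ext_power_omega1 : ext_power in_g1 2 omega1.
Proof.
rewrite omega1E; apply: ext_powerB.
  exact: (@ext_power_basis _ _ in_g1 [:: e3; e5]).
exact: (@ext_power_basis _ _ in_g1 [:: e4; e6]).
Qed.

Lemma ext_power_omega2 : ext_power in_g1 2 omega2.
Proof.
rewrite omega2E; apply: ext_powerB.
  exact/ext_powerN/(@ext_power_basis _ _ in_g1 [:: e3; e6]).
exact: (@ext_power_basis _ _ in_g1 [:: e4; e5]).
Qed.

Lemma hodge_g1_omega7 : hodge_g1 omega7 = omega7.
Proof.
rewrite hodge_g1_star vol_g1E omega7E starDr !star_basis_cons // !star_basis_nil /=.
by apply/funext => s; rewrite !cochainE; ring.
Qed.

Lemma hodge_g1_omega1 : hodge_g1 omega1 = omega1.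
Proof.
rewrite hodge_g1_star vol_g1E omega1E starBr !star_basis_cons // !star_basis_nil /=.
by apply/funext => s; rewrite !cochainE; ring.
Qed.

Lemma hodge_g1_omega2 : hodge_g1 omega2 = omega2.
Proof.
rewrite hodge_g1_star vol_g1E omega2E starBr starNr.
rewrite !star_basis_cons // !star_basis_nil /=.
by apply/funext => s; rewrite !cochainE; ring.
Qed.

Lemma phi0E : phi0 = extmuls [:: e1; e2; e7] (unit_cochain : form) +
  extmul e7 omega7 + extmul e1 omega1 + extmul e2 omega2.
Proof.
rewrite omega7E omega1E omega2E /Defs.phi0 !eeE /= !inord7 !basis_cons !extmul_linear.
rewrite !(extmul_cycle e7) -[unit_cochain]/(basis_cochain R [::]).
by apply/funext => s; rewrite /fadd /fsub !cochainE; ring.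
Qed.

Lemma hodge_e7 n f : ext_power in_g1 n f ->
  hodge (extmul e7 f) = extmuls [:: e1; e2] (hodge_g1 f).
Proof.
move=> g1f; rewrite hodge_star hodge_g1_star volE vol_g1E star_basis_extmul //.
rewrite -(star_extmuls2l _ _ g1f) //; last exact: alternating_basis.
by rewrite -signr_odd scale1r.
Qed.

Lemma hodge_e1 n f : ext_power in_g1 n f ->
  hodge (extmul e1 f) = extmuls [:: e2; e7] (hodge_g1 f).
Proof.
move=> g1f; rewrite hodge_star hodge_g1_star volE vol_g1E star_basis_extmul //.
rewrite -(star_extmuls2l _ _ g1f) //; last exact: alternating_basis.
by rewrite scale1r /= -basis_e34567 -basis_cons.
Qed.

Lemma hodge_e2 n f : ext_power in_g1 n f ->
  hodge (extmul e2 f) = - extmuls [:: e1; e7] (hodge_g1 f).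
Proof.
move=> g1f; rewrite hodge_star hodge_g1_star volE vol_g1E star_basis_extmul //.
rewrite -(star_extmuls2l _ _ g1f) //; last exact: alternating_basis.
by rewrite scaleN1r /= -basis_e34567 -basis_cons.
Qed.

Lemma hodgeD f g : hodge (f + g) = hodge f + hodge g.
Proof. by rewrite !hodge_star starDr. Qed.

Lemma hodgeZ c f : hodge (c *: f) = c *: hodge f.
Proof. by rewrite !hodge_star starZr. Qed.

Lemma hodge_g1_unit : hodge_g1 unit_cochain = vol_g1.
Proof. by rewrite hodge_g1_star star_unit. Qed.

Lemma hodge_g1_vol_g1 : hodge_g1 vol_g1 = unit_cochain.
Proof.
rewrite hodge_g1_star vol_g1E !star_basis_cons //= star_basis_nil.
by rewrite !scale1r.
Qed.

Lemma ext_power_vol_g1 : ext_power in_g1 4 vol_g1.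
Proof. by rewrite vol_g1E; apply: (@ext_power_basis _ _ in_g1 [:: e3; e4; e5; e6]). Qed.

Lemma theta_vol_g1 M : theta M vol_g1 = - (\tr M *: vol_g1).
Proof. by rewrite theta_derive derive_extg1_vol_g1. Qed.

Lemma hodge_phi0 : hodge phi0 =
  vol_g1 + extmuls [:: e1; e2] omega7 + extmuls [:: e2; e7] omega1
  - extmuls [:: e1; e7] omega2.
Proof.
rewrite phi0E !hodgeD hodge_e127 hodge_g1_unit.
rewrite (hodge_e7 ext_power_omega7) (hodge_e1 ext_power_omega1).
rewrite (hodge_e2 ext_power_omega2).
by rewrite hodge_g1_omega7 hodge_g1_omega1 hodge_g1_omega2.
Qed.

Section Codifferential.
Variables (A1 : 'M[R]_2) (A B C : 'M[R]_4).
Hypotheses (trB : \tr B = 0) (trC : \tr C = 0).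
Local Notation d := (dform (sc A1 A B C) : form -> form).

Definition gamma_form : form :=
  theta A omega7 - \tr A1 *: omega7 + theta B omega1 + theta C omega2.

Definition beta_form : form :=
  (\tr A1 + \tr A) *: omega7 + theta A^T omega7
  + theta B^T omega1 + theta C^T omega2.

Lemma ext_power_gamma_form : ext_power in_g1 2 gamma_form.
Proof.
apply: ext_powerD (ext_power_theta C ext_power_omega2).
apply: ext_powerD (ext_power_theta B ext_power_omega1).
apply: ext_powerB (ext_power_theta A ext_power_omega7) _.
exact: ext_powerZ ext_power_omega7.
Qed.

Lemma ext_power_beta_form : ext_power in_g1 2 beta_form.
Proof.
apply: ext_powerD (ext_power_theta C^T ext_power_omega2).
apply: ext_powerD (ext_power_theta B^T ext_power_omega1).
apply: ext_powerD (ext_power_theta A^T ext_power_omega7).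
exact: ext_powerZ ext_power_omega7.
Qed.

Lemma dform_hodge_phi0 : d (hodge phi0) =
  - (\tr A *: extmul e7 vol_g1) + extmuls [:: e1; e2; e7] gamma_form.
Proof.
rewrite hodge_phi0 dformB !dformD (dform_g1 _ _ _ _ ext_power_vol_g1).
rewrite (dform_e12 _ _ _ _ ext_power_omega7) (dform_e27 _ _ _ _ ext_power_omega1).
rewrite (dform_e17 _ _ _ _ ext_power_omega2) !theta_vol_g1 trB trC.
rewrite !scale0r oppr0 !extmul0 !addr0.
by rewrite !extmulsD opprK extmulN extmulZ !addrA.
Qed.

Lemma hodge_dform_hodge_phi0 : hodge (d (hodge phi0)) =
  - (\tr A *: basis_cochain R [:: e1; e2]) + hodge_g1 gamma_form.
Proof.
rewrite dform_hodge_phi0 hodgeD hodge_e127 -scaleNr hodgeZ (hodge_e7 ext_power_vol_g1).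
by rewrite hodge_g1_vol_g1 scaleNr.
Qed.

Lemma hodge_g1_gamma_form : hodge_g1 gamma_form = - beta_form.
Proof.
rewrite hodge_g1_star /gamma_form 2!starDr starBr starZr -!hodge_g1_star.
rewrite (hodge_g1_theta _ ext_power_omega7) (hodge_g1_theta _ ext_power_omega1).
rewrite (hodge_g1_theta _ ext_power_omega2).
rewrite hodge_g1_omega7 hodge_g1_omega1 hodge_g1_omega2 trB trC !scale0r !add0r.
rewrite /beta_form !opprD scalerDl.
by apply/funext => s; rewrite !cochainE; ring.
Qed.

Lemma dform_hodge_dform_hodge_phi0 : d (hodge (d (hodge phi0))) =
  (\tr A1 * \tr A) *: extmuls [:: e1; e2; e7] (unit_cochain : form)
  - extmul e7 (theta A beta_form) - extmul e1 (theta B beta_form)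
  - extmul e2 (theta C beta_form).
Proof.
rewrite hodge_dform_hodge_phi0 hodge_g1_gamma_form dformB dformN dformZ.
rewrite (dform_g1 _ _ _ _ ext_power_beta_form).
rewrite (dform_e12 _ _ _ _ (ext_power_unit _ _)).
rewrite theta_derive derive_unit oppr0 sub0r extmulsN extmulsZ scalerN opprK scalerA.
by rewrite (mulrC (\tr A)) !opprD !addrA.
Qed.

End Codifferential.

End G2.

Theorem theorem2p4 (R : realFieldType) (A1 : 'M[R]_2) (A B C : 'M[R]_4) :
  \tr B = 0 -> \tr C = 0 ->
  A *m B - B *m A = A1 0 0 *: B + A1 1 0 *: C ->
  A *m C - C *m A = A1 0 1 *: B + A1 1 1 *: C ->
  B *m C - C *m B = 0 ->
  let d := dform (sc A1 A B C) in
  let sphi := hodge phi0 in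
  let gam := (theta A omega7 \- \tr A1 \*: omega7 \+ theta B omega1
              \+ theta C omega2)%F in
  let beta := ((\tr A1 + \tr A) \*: omega7 \+ theta A^T omega7
               \+ theta B^T omega1 \+ theta C^T omega2)%F in
  [/\ sphi = (ee R [:: 3; 4; 5; 6]%N \+ omega7 \wedge ee R [:: 1; 2]%N
              \+ omega1 \wedge ee R [:: 2; 7]%N \- omega2 \wedge ee R [:: 1; 7]%N)%F,
      d sphi = ((- \tr A) \*: ee R [:: 3; 4; 5; 6; 7]%N \+ gam \wedge ee R [:: 1; 2; 7]%N)%F,
      hodge (d sphi) = ((- \tr A) \*: ee R [:: 1; 2]%N \+ hodge_g1 gam)%F &
      d (hodge (d sphi)) = ((\tr A1 * \tr A) \*: ee R [:: 1; 2; 7]%N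
                            \- theta A beta \wedge ee R [:: 7]%N
                            \- theta B beta \wedge ee R [:: 1]%N
                            \- theta C beta \wedge ee R [:: 2]%N)%F].
Proof.
move=> trB trC _ _ _ d sphi gam beta.
have gamE : gam = gamma_form A1 A B C by [].
have betaE : beta = beta_form A1 A B C by [].
have theta_beta_g1 M := ext_power_theta M (ext_power_beta_form A1 A B C).
rewrite /d /sphi gamE betaE !eeE /= !inord7.
rewrite (wedge_basis_even _ (ext_power_omega7 R)) //.
rewrite (wedge_basis_even _ (ext_power_omega1 R)) //.
rewrite (wedge_basis_even _ (ext_power_omega2 R)) //.
rewrite (wedge_basis_even _ (ext_power_gamma_form A1 A B C)) //.
rewrite !(wedge_basis_even _ (theta_beta_g1 _)) // !formE.
split.
- by rewrite hodge_phi0 vol_g1E.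
- by rewrite dform_hodge_phi0 // vol_g1E basis_e34567 scaleNr.
- by rewrite hodge_dform_hodge_phi0 // scaleNr.
- exact: dform_hodge_dform_hodge_phi0.
Qed.
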